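(* The following hold. 1. Let $\gamma\ge 1$ be an ordinal. If $f\colon\mathbb{N}\to\mathbb{N}$ belongs to $\mathfrak{F}_\gamma$ and is monotone (nondecreasing) with $f(x)\ge\max\{1,x\}$ for all $x$, then for each $c\ge 1$ there exists a function $M_c\in\mathfrak{F}_{\gamma+c-1}$ such that $R^f_c(a)\le M_c(a)$ for all $a\in\mathbb{N}$. 2. For every ordinal $\gamma$ and every $c\ge 1$, $R^{F_\gamma}_c(a)\ge F_{\gamma+c-1}(a)$ for all $a\in\mathbb{N}$.
   Context: $\mathbb{N}$ is the set of nonnegative integers, and $c\in\mathbb{N}$ is identified with $\{0,\dots,c-1\}$. For $a,R\in\mathbb{N}$, $[a,R]=\{n\in\mathbb{N}:a\le n\le R\}$ and $[a,R]^2=\{(n,m)\in\mathbb{N}^2:a\le n<m\le R\}$. For a coloring $C\colon[a,R]^2\to c$, a set $H=\{h_0<h_1<\cdots\}\subseteq[a,R]$ is $C$-weakly homogeneous if $C(h_i,h_{i+1})=C(h_{i+1},h_{i+2})$ for all $h_i,h_{i+1},h_{i+2}\in H$. For $f\colon\mathbb{N}\to\mathbb{N}$, $R^f_c(a)$ is the smallest $R$ such that for every coloring $C\colon[a,R]^2\to c$ there is a (nonempty) $C$-weakly homogeneous set $H\subseteq[a,R]$ with $|H|>f(\min H)$. $F_\gamma$ is the $\gamma$-th fast growing function in the sense of Löb and Wainer: $F_0(x)=x+1$, $F_{\gamma+1}(x)=F_\gamma^{(x+1)}(x)$ (the $(x+1)$-fold iterate), and $F_\lambda(x)=F_{\lambda[x]}(x)$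 for limit $\lambda$, where $(\lambda[x])_{x\in\mathbb{N}}$ is the standard fundamental sequence of $\lambda$: for Cantor normal forms, $(\delta+\omega^{\beta+1})[x]=\delta+\omega^\beta\cdot x$ and $(\delta+\omega^{\beta})[x]=\delta+\omega^{\beta[x]}$ for limit $\beta$. Ordinals $\gamma$ range over those for which $F_\gamma$ is so defined ($\gamma<\varepsilon_0$). Here $\gamma+c-1$ means $\gamma+(c-1)$ for $c\ge 1$. $\mathfrak{F}_\gamma$ is the smallest class of functions (of arbitrary arity on $\mathbb{N}$) which contains the constants, sum, projections and $F_\gamma$, and is closed under composition and bounded primitive recursion (primitive recursion whose result is bounded by a function already in the class). *)

(* Defs.v *)
From mathcomp Require Import all_boot.
Set Implicit Arguments.
Unset Strict Implicit.
Unset Printing Implicit Defensive.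

(* [W a b] stands for omega^a + b. A term all of whose sums are nonincreasing
   (predicate [nf] below) is a Cantor normal form, so that the terms
   satisfying [nf] are exactly the ordinals below epsilon_0. *)
Inductive ord : Set := Zero | W (a b : ord).

Fixpoint ocmp (g d : ord) : comparison :=
  match g, d with
  | Zero, Zero => Eq
  | Zero, W _ _ => Lt
  | W _ _, Zero => Gt
  | W a b, W a' b' => match ocmp a a' with Eq => ocmp b b' | r => r end
  end.

(* The order of the ordinals denoted, when both terms are normal forms. *)
Definition ole (g d : ord) : bool := if ocmp g d is Gt then false else true.

Fixpoint nf (g : ord) : bool :=
  if g is W a b then
    [&& nf a, nf b & if b is W a' _ then ole a' a else true]
  else true.

Fixpoint osucc (g : ord) : ord :=
  if g is W a b then W a (osucc b) else W Zero Zero.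

Definition oaddn (g : ord) (n : nat) : ord := iter n osucc g.

Definition oone : ord := osucc Zero.

(* omega^a * x *)
Definition opowmul (a : ord) (x : nat) : ord := iter x (W a) Zero.

(* Zero, the successor of an ordinal, or a limit together with its standard
   fundamental sequence. *)
Variant okind : Set := KZero | KSucc (d : ord) | KLim (s : nat -> ord).

Fixpoint kind (g : ord) : okind :=
  match g with
  | Zero => KZero
  | W a b =>
    match kind b with
    | KZero =>
      match kind a with
      | KZero => KSucc Zero
      | KSucc a' => KLim (fun x => opowmul a' x)
      | KLim s => KLim (fun x => W (s x) Zero)
      end
    | KSucc b' => KSucc (W a b')
    | KLim s => KLim (fun x => W a (s x))
    end
  end.

Definition kstep (k : okind) (d : ord) : Prop :=
  match k with
  | KZero => False
  | KSucc e => d = e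
  | KLim s => exists x, d = s x
  end.

Definition ostep (d g : ord) : Prop := kstep (kind g) d.

Fixpoint ocat (d b : ord) : ord := if d is W a d' then W a (ocat d' b) else b.

Lemma ocat0 d : ocat d Zero = d.
Proof. by elim: d => [|a _ d IH] /=; rewrite ?IH. Qed.

Lemma kind_KZero g : kind g = KZero -> g = Zero.
Proof.
by case: g => //= a b; case: (kind b) => //; case: (kind a).
Qed.

Lemma kind_ocat d b : kind (ocat d b) =
  match kind b with
  | KZero => kind d
  | KSucc e => KSucc (ocat d e)
  | KLim s => KLim (fun x => ocat d (s x))
  end.
Proof.
elim: d => [|a _ d IH] /=; first by case E: (kind b) => //; rewrite (kind_KZero E).
by rewrite IH; case: (kind b).
Qed.

Lemma Acc_ocat b : Acc ostep b -> forall d, Acc ostep d -> Acc ostep (ocat d b).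
Proof.
elim=> {}b _ IH d Hd; case E: (kind b) => [|e|s].
- by rewrite (kind_KZero E) ocat0.
- constructor=> y; rewrite /ostep kind_ocat E /= => ->.
  by apply: IH => //; rewrite /ostep E.
- constructor=> y; rewrite /ostep kind_ocat E /= => -[x ->].
  by apply: IH => //; rewrite /ostep E; exists x.
Qed.

Lemma Acc_Zero : Acc ostep Zero.
Proof. by constructor=> y []. Qed.

Lemma Acc_opow a : Acc ostep a -> Acc ostep (W a Zero).
Proof.
elim=> {}a _ IH; constructor=> y; rewrite /ostep /=.
case E: (kind a) => [|a'|s] /=.
- by move=> ->; exact: Acc_Zero.
- case=> x ->; have Ha' : Acc ostep (W a' Zero) by apply: IH; rewrite /ostep E.
  elim: x => [|x IHx]; first exact: Acc_Zero.
  exact: (Acc_ocat IHx Ha').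
- by case=> x ->; apply: IH; rewrite /ostep E; exists x.
Qed.

Lemma ostep_wf : well_founded ostep.
Proof.
elim=> [|a Ha b Hb]; first exact: Acc_Zero.
exact: (Acc_ocat Hb (Acc_opow Ha)).
Qed.

Definition fast_body (k : okind) :
    (forall d, kstep k d -> nat -> nat) -> nat -> nat :=
  match k with
  | KZero => fun _ x => x.+1
  | KSucc d => fun rec x => iter x.+1 (rec d erefl) x
  | KLim s => fun rec x => rec (s x) (ex_intro _ x erefl) x
  end.

Fixpoint fast_acc (g : ord) (H : Acc ostep g) {struct H} : nat -> nat :=
  @fast_body (kind g) (fun d Hd => fast_acc (Acc_inv H Hd)).

(* The fast growing functions F_g; recursion along [ostep] terminates on all
   terms, but F_g has its usual meaning only when [nf g]. *)
Definition F (g : ord) : nat -> nat := fast_acc (ostep_wf g).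

Lemma fast_body_ext k (r1 r2 : forall d, kstep k d -> nat -> nat) :
  (forall d Hd, r1 d Hd =1 r2 d Hd) -> fast_body r1 =1 fast_body r2.
Proof.
case: k r1 r2 => [|d|s] //= r1 r2 E x; last exact: E.
by rewrite E; congr (r2 _ _ _); apply: eq_iter; exact: E.
Qed.

Lemma fast_accE g (H : Acc ostep g) :
  fast_acc H =1 @fast_body (kind g) (fun d Hd => fast_acc (Acc_inv H Hd)).
Proof. by case: H. Qed.

Lemma fast_acc_irr g (H1 H2 : Acc ostep g) : fast_acc H1 =1 fast_acc H2.
Proof.
elim: (ostep_wf g) H1 H2 => {}g _ IH H1 H2 x; rewrite !fast_accE.
by apply: fast_body_ext => d Hd; exact: IH.
Qed.

Lemma FE g x : F g x =
  match kind g with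
  | KZero => x.+1
  | KSucc d => iter x.+1 (F d) x
  | KLim s => F (s x) x
  end.
Proof.
rewrite /F fast_accE (fast_body_ext (r2 := fun d _ => F d)).
  by case: (kind g).
by move=> d Hd y; exact: fast_acc_irr.
Qed.

Lemma kind_osucc g : kind (osucc g) = KSucc g.
Proof. by elim: g => //= a _ b ->. Qed.

Lemma F_Zero x : F Zero x = x.+1.
Proof. by rewrite FE. Qed.

Lemma F_osucc g x : F (osucc g) x = iter x.+1 (F g) x.
Proof. by rewrite FE kind_osucc. Qed.

(* The class generated by F_g. Functions are considered up to extensional
   equality. *)
Inductive fclass (g : ord) : forall n : nat, (n.-tuple nat -> nat) -> Prop :=
| fclass_ext n (h h' : n.-tuple nat -> nat) :
    h =1 h' -> fclass g h -> fclass g h'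
| fclass_const n (k : nat) : fclass g (fun _ : n.-tuple nat => k)
| fclass_sum : fclass g (fun v : 2.-tuple nat => tnth v ord0 + tnth v ord_max)
| fclass_proj n (i : 'I_n) : fclass g (fun v : n.-tuple nat => tnth v i)
| fclass_fast : fclass g (fun v : 1.-tuple nat => F g (tnth v ord0))
| fclass_comp m n (h : m.-tuple nat -> nat) (k : 'I_m -> n.-tuple nat -> nat) :
    fclass g h -> (forall i, fclass g (k i)) ->
    fclass g (fun v => h [tuple k i v | i < m])
| fclass_rec n (h0 : n.-tuple nat -> nat) (hS : n.+2.-tuple nat -> nat)
      (h bound : n.+1.-tuple nat -> nat) :
    fclass g h0 -> fclass g hS -> fclass g bound ->
    (forall v : n.-tuple nat, h [tuple of 0 :: v] = h0 v) ->
    (forall x (v : n.-tuple nat), h [tuple of x.+1 :: v] =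
        hS [tuple of [:: x, h [tuple of x :: v] & v]]) ->
    (forall v, h v <= bound v) ->
    fclass g h.

Definition fclass1 (g : ord) (f : nat -> nat) : Prop :=
  fclass g (fun v : 1.-tuple nat => f (tnth v ord0)).

(* A finite set {h_0 < h_1 < ...} is represented by the strictly increasing
   list of its elements. *)
Definition weakly_homogeneous (C : nat -> nat -> nat) (H : seq nat) : Prop :=
  forall i, i.+2 < size H ->
    C (nth 0 H i) (nth 0 H i.+1) = C (nth 0 H i.+1) (nth 0 H i.+2).

(* The values of a coloring outside [a, R]^2 are irrelevant, hence
   unconstrained. *)
Definition coloring (c a R : nat) (C : nat -> nat -> nat) : Prop :=
  forall n m, a <= n -> n < m -> m <= R -> C n m < c.

Definition weak_ramsey (f : nat -> nat) (c a R : nat) : Prop :=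
  forall C, coloring c a R C ->
    exists H : seq nat,
      [/\ H <> [::], sorted ltn H, all (fun h => a <= h <= R) H,
          weakly_homogeneous C H & f (head 0 H) < size H].

(* [is_ramsey_number f c a R] means that R^f_c(a) exists and is equal to R. *)
Definition is_ramsey_number (f : nat -> nat) (c a R : nat) : Prop :=
  weak_ramsey f c a R /\ forall R', weak_ramsey f c a R' -> R <= R'.

(* Main.v *)
(** Upper bound. Label each n in [a, R] by the vector whose j-th entry is the
    length of the longest increasing chain starting at n all of whose steps
    have color j. If no large weakly homogeneous set exists, the labels are
    bounded by f, and C(n, m) = j makes the j-th label drop strictly from n to
    m: the labels form an f-controlled bad sequence in N^c. Following
    Figueira, Figueira, Schmitz and Schnoebelen, the remainder of such a
    sequence is kept covered by finitely many subspaces; reading a term trades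
    a p-dimensional subspace for at most c * f t subspaces of dimension p - 1,
    which bounds the length by a fast growing hierarchy with step c * f. Every
    function of the class of F_g, g >= 1, is majorized by an iterate of F_g,
    so this hierarchy is majorized by an iterate of F_{g+c-1}, and that iterate
    is the bound M_c.

    Lower bound. Cut [a, F_{d+1} a) into the a + 1 blocks [x, F_d x), color
    inside the blocks by induction and between blocks by a new color, whose
    chains then have at most a + 1 <= F_g (min H) elements. *)
Require Import Defs.
From mathcomp Require Import all_boot.
From Stdlib Require Import Classical_Prop.
Set Implicit Arguments.
Unset Strict Implicit.
Unset Printing Implicit Defensive.

(** * Monotonicity and growth of the functions [F g] *)

Lemma iter_inflate (e : nat -> nat) n x :
  (forall y, y <= e y) -> x <= iter n e x.
Proof. by move=> He; elim: n => //= n IH; exact: leq_trans IH (He _). Qed.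

Lemma leq_iter (e e' : nat -> nat) n n' x x' :
  (forall y y', y <= y' -> e y <= e' y') -> (forall y, y <= e' y) ->
  n <= n' -> x <= x' -> iter n e x <= iter n' e' x'.
Proof.
move=> He Hi; elim: n n' => [|n IH] [|n'] //= Hn Hx; last by apply/He/IH.
exact: leq_trans Hx (@iter_inflate _ n'.+1 _ Hi).
Qed.

(* One step goes from d + 1 to d, or from a limit l to l[y]; the point is that
   F_d y <= F_g y whenever d is reached from g. *)
Inductive down (y : nat) : ord -> ord -> Prop :=
| down_refl g : down y g g
| down_succ g e d : kind g = KSucc e -> down y e d -> down y g d
| down_lim g s d : kind g = KLim s -> down y (s y) d -> down y g d.

Lemma down_trans y g d e : down y g d -> down y d e -> down y g e.
Proof.
move=> H; elim: H e => // [{}g d' {}d k _ IH|{}g s {}d k _ IH] e He.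
- exact: down_succ k (IH _ He).
- exact: down_lim k (IH _ He).
Qed.

Lemma down_ocat y p g d : down y g d -> down y (ocat p g) (ocat p d).
Proof.
elim=> [{}g|{}g e {}d k _ IH|{}g s {}d k _ IH]; first exact: down_refl.
- by apply: down_succ IH; rewrite kind_ocat k.
- by apply: (@down_lim _ _ (fun x => ocat p (s x))) => //; rewrite kind_ocat k.
Qed.

Lemma down_Zero y g : down y g Zero.
Proof.
elim: (ostep_wf g) => {}g _; rewrite /ostep.
case k: (kind g) => [|e|s] IH.
- by rewrite (kind_KZero k); exact: down_refl.
- by apply: (down_succ k); exact: IH.
- by apply: (down_lim k); apply: IH; exists y.
Qed.

Lemma opowmulD a m n : opowmul a (m + n) = ocat (opowmul a m) (opowmul a n).
Proof. by rewrite /opowmul; elim: m => //= m ->. Qed.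

Lemma down_opowmul y a m n : m <= n -> down y (opowmul a n) (opowmul a m).
Proof.
move=> /subnKC <-; rewrite opowmulD -[X in down _ _ X]ocat0.
exact/down_ocat/down_Zero.
Qed.

(** For [y = 0] the step from omega^(e+1) leads to 0 and misses omega^e; for [0 < y] it leads to
    omega^e * y, which descends to omega^e. *)
Lemma down_opow y g d : 0 < y -> down y g d -> down y (W g Zero) (W d Zero).
Proof.
move=> y_gt0; elim=> [{}g|{}g e {}d k _ IH|{}g s {}d k _ IH].
- exact: down_refl.
- apply: (@down_lim _ _ (opowmul e)); first by rewrite /= k.
  exact: down_trans (@down_opowmul y e 1 y y_gt0) IH.
- by apply: (@down_lim _ _ (fun x => W (s x) Zero)) => //=; rewrite k.
Qed.

(** For a limit l, this descent gives F_{l[x]} y <= F_{l[y]} y, the limit case of monotonicity. *)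
Lemma down_fund y x g s :
  0 < y -> x <= y -> kind g = KLim s -> down y (s y) (s x).
Proof.
move=> y_gt0 xy; elim: g s => [|a IHa b IHb] //= s.
case kb: (kind b) => [|//|s'].
- case ka: (kind a) => [//|a'|s'] [<-]; first exact: down_opowmul.
  exact/down_opow/IHa.
- by case=> <-; apply: (@down_ocat y (W a Zero)); exact: IHb.
Qed.

Lemma F_gt g x : x < F g x.
Proof.
elim: (ostep_wf g) x => {}g _ + x; rewrite FE /ostep.
case: (kind g) => [|d|s] //= IH; last by apply: IH; exists x.
apply: leq_ltn_trans (IH d erefl _).
by apply: iter_inflate => y; exact/ltnW/IH.
Qed.

Lemma F_ge g x : x <= F g x.
Proof. exact/ltnW/F_gt. Qed.

Lemma F_down y g d : down y g d -> F d y <= F g y.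
Proof.
elim=> [//|{}g e {}d k _ IH|{}g s {}d k _ IH].
- rewrite (FE g) k /=; apply: leq_trans IH _; rewrite -iterS iterSr.
  exact/iter_inflate/F_ge.
- by rewrite (FE g) k.
Qed.

Lemma F_mono g x y : x <= y -> F g x <= F g y.
Proof.
elim: (ostep_wf g) x y => {}g _; rewrite /ostep => + x y xy.
case k: (kind g) => [|d|s] IH; rewrite !(FE g) k //.
- apply: leq_iter => //; last exact: F_ge.
  by move=> u v; exact: IH.
- apply: (@leq_trans (F (s x) y)); first by apply: IH => //; exists x.
  case: (posnP y) xy => [->|y_gt0 xy]; first by rewrite leqn0 => /eqP ->.
  exact/F_down/(down_fund y_gt0 xy k).
Qed.

Lemma fund_neq0 g s x : 0 < x -> kind g = KLim s -> s x <> Zero.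
Proof.
case: x => // x _; case: g => //= a b.
by case: (kind b) => [|//|s' [<-]] //; case: (kind a) => [//|a'|s'] [<-].
Qed.

Lemma F_ge_double g x : g <> Zero -> x.*2 <= F g x.
Proof.
case: x => // x; elim: (ostep_wf g) => {}g _; rewrite /ostep.
case k: (kind g) => [|d|s] IH gn0; rewrite (FE g) k.
- by case: gn0; exact: kind_KZero.
- have [->|dn0] : d = Zero \/ d <> Zero by case: (d) => [|? ?]; [left|right].
    suff -> n y : iter n (F Zero) y = y + n by rewrite -addnn leq_add2l.
    by elim: n => [|n IHn]; rewrite ?addn0 //= IHn F_Zero addnS.
  rewrite iterSr; apply: leq_trans (IH d erefl dn0) _.
  exact/iter_inflate/F_ge.
- by apply: IH; [exists x.+1 | exact: fund_neq0 k].
Qed.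

(** * Majorization by iterates of [F g] *)

Lemma leq_iterF g m n x y :
  m <= n -> x <= y -> iter m (F g) x <= iter n (F g) y.
Proof.
by move=> mn xy; apply: leq_iter => //; [exact: F_mono | exact: F_ge].
Qed.

Lemma iterF_ge g m x : x <= iter m (F g) x.
Proof. exact/iter_inflate/F_ge. Qed.

Lemma F_le_osucc g x y : x <= y -> F g x <= F (osucc g) y.
Proof.
move=> /(F_mono g) /leq_trans; apply; rewrite F_osucc iterSr.
exact: iterF_ge.
Qed.

Lemma leq_iterF_oaddn g p m x : iter m (F g) x <= iter m (F (oaddn g p)) x.
Proof.
elim: p => // p IH; apply: leq_trans IH _.
by apply: leq_iter => //; [exact: F_le_osucc | exact: F_ge].
Qed.

Lemma iterF_add g m n x a b : g <> Zero ->
  a <= iter m (F g) x -> b <= iter n (F g) x ->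
  a + b <= iter (maxn m n).+1 (F g) x.
Proof.
move=> gn0 Ha Hb; apply: leq_trans (F_ge_double _ gn0).
rewrite -addnn; apply: leq_add.
- exact: leq_trans Ha (leq_iterF _ (leq_maxl _ _) (leqnn _)).
- exact: leq_trans Hb (leq_iterF _ (leq_maxr _ _) (leqnn _)).
Qed.

Lemma iterF_mul g c x : g <> Zero -> c * x <= iter c (F g) x.
Proof.
move=> gn0; elim: c => // c IH; rewrite mulSn.
by have := @iterF_add g 0 c x x _ gn0 (leqnn x) IH; rewrite max0n.
Qed.

Lemma iterF_const g k x : k <= iter k (F g) x.
Proof. by elim: k => //= k IH; exact: leq_ltn_trans IH (F_gt _ _). Qed.

(** Composition adds iteration counts; a bounded recursion takes over the count of its bound. *)
Lemma fclass_majorized g n (h : n.-tuple nat -> nat) : g <> Zero ->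
  fclass g h -> exists m, forall v x, (forall i, tnth v i <= x) ->
    h v <= iter m (F g) x.
Proof.
move=> gn0; elim.
- by move=> {h}n h h' hh' _ [m Hm]; exists m => v x /Hm; rewrite hh'.
- by move=> {h}n k; exists k => v x _; exact: iterF_const.
- exists 1 => v x Hv; apply: leq_trans (F_ge_double _ gn0).
  by rewrite -addnn leq_add.
- by move=> {h}n i; exists 0 => v x; apply.
- by exists 1 => v x Hv; exact: F_mono.
- move=> {h n} m n h k _ [m1 IHh] _ IHk.
  have [m2 Hm2] : exists m2, forall i v x, (forall i, tnth v i <= x) ->
      k i v <= iter m2 (F g) x.
    have [m2 Hm2] := fin_all_exists IHk.
    exists (\max_i m2 i) => i v x Hv; apply: leq_trans (Hm2 i v x Hv) _.
    exact: leq_iterF (leq_bigmax _) _.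
  exists (m1 + m2) => v x Hv; rewrite iterD; apply: IHh => i.
  by rewrite tnth_mktuple; exact: Hm2.
- move=> {h}n h0 hS h bound _ _ _ _ _ [m Hm] _ _ Hb.
  by exists m => v x Hv; exact: leq_trans (Hb v) (Hm v x Hv).
Qed.

Lemma fclass1_majorized g f : g <> Zero -> fclass1 g f ->
  exists m, forall x, f x <= iter m (F g) x.
Proof.
move=> gn0 /(fclass_majorized gn0) [m Hm]; exists m => x.
by apply: (Hm [tuple x]) => i; rewrite (tnth_nth 0) ord1.
Qed.

Lemma fclass1_iterF g m : fclass1 g (iter m (F g)).
Proof.
rewrite /fclass1; elim: m => [|m IH]; first exact: fclass_proj.
apply: fclass_ext (fclass_comp (fclass_fast g) (fun=> IH)).
by move=> v; rewrite tnth_mktuple.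
Qed.

(** * Weakly homogeneous sets as monochromatic chains; the lower bound *)

Definition color_edge (C : nat -> nat -> nat) (j u v : nat) : bool :=
  (u < v) && (C u v == j).

Lemma color_path_ltn C j x s : path (color_edge C j) x s -> path ltn x s.
Proof. by apply: sub_path => u v /andP[]. Qed.

Lemma ltn_path_last x s : path ltn x s -> x + size s <= last x s.
Proof.
elim: s x => [|y s IH] x /=; first by rewrite addn0.
by case/andP=> xy /IH; apply: leq_trans; rewrite addnS -addSn leq_add2r.
Qed.

Lemma weakly_homogeneous_path C x s :
  sorted ltn (x :: s) -> weakly_homogeneous C (x :: s) ->
  exists j, path (color_edge C j) x s.
Proof.
move=> Hs wh; exists (C x (head 0 s)).
elim: s x Hs wh => [|y s IH] x //= /andP[xy Hs] wh.
rewrite {1}/color_edge xy eqxx /=.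
have := IH y Hs (fun i Hi => wh i.+1 Hi).
by case: s Hs wh {IH} => //= z s _ wh; rewrite -(wh 0 isT).
Qed.

Lemma path_weakly_homogeneous C j x s :
  path (color_edge C j) x s -> weakly_homogeneous C (x :: s).
Proof.
elim: s x => [|y s IH] x //= /andP[/andP[_ /eqP xy] Hs] [|i].
  by case: s Hs {IH} => //= z s /andP[/andP[_ /eqP yz] _] _; rewrite xy yz.
exact: (IH y Hs i).
Qed.

(* In the conclusion k is the new color, separating the n blocks. *)
Lemma blocks (f e : nat -> nat) (k : nat) :
  (forall a, exists C, (forall u v, C u v < k) /\
    forall j x s, a <= x -> path (color_edge C j) x s -> last x s < e a ->
      size s < f x) ->
  forall n a, exists C, (forall u v, C u v < k.+1) /\
    forall j x s, a <= x -> path (color_edge C j) x s ->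
      last x s < iter n e a ->
      size s < if j == k then n else f x.
Proof.
move=> He; elim=> [|n IH] a.
  exists (fun _ _ => 0); split=> // j x s ax /color_path_ltn /ltn_path_last /=.
  by move=> H /(leq_ltn_trans H); rewrite ltnNge (leq_trans ax) ?leq_addr.
have [Ca [Ca_lt HCa]] := He a; have [Cb [Cb_lt HCb]] := IH (e a).
(* The first block is [a, e a): [Ca] inside it, [k] on edges leaving it, [Cb] beyond. *)
pose C u v := if u < e a then if v < e a then Ca u v else k else Cb u v.
have C_ge j x s : e a <= x -> path (color_edge C j) x s ->
      path (color_edge Cb j) x s.
  elim: s x => [|y s IHs] x //= ax /andP[/andP[xy]].
  rewrite {1}/C ltnNge ax /= /color_edge xy => -> /= /IHs; apply.
  exact: leq_trans ax (ltnW xy).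
have C_lt j x s : j != k -> x < e a -> path (color_edge C j) x s ->
    path (color_edge Ca j) x s /\ last x s < e a.
  move=> jk; elim: s x => [|y s IHs] x //= xa /andP[/andP[xy]].
  rewrite {1}/C xa; case: ifP => [ya|_]; last by rewrite eq_sym (negbTE jk).
  by move=> Cxy /(IHs _ ya) [-> ->]; rewrite /color_edge xy Cxy.
exists C; split=> [u v|j x s ax Hs Hl].
  by rewrite /C; case: ifP => // _; case: ifP => // _; rewrite ltnS ltnW.
rewrite iterSr in Hl; case: (leqP (e a) x) => [eax|xea].
  have := HCb j x s eax (C_ge _ _ _ eax Hs) Hl.
  by case: ifP => // _ /leq_trans; apply.
case: (eqVneq j k) Hs => [->|jk] Hs; last first.
  by have [Hs' Hl'] := C_lt j x s jk xea Hs; exact: HCa Hs' Hl'.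
(* A chain of color [k] leaves the first block with its first edge, since [Ca] avoids [k]. *)
case: s Hs Hl => //= y s /andP[/andP[xy]]; rewrite {1}/C xea.
case: ifP => [_ /eqP Ck|/negbT]; first by have := Ca_lt x y; rewrite Ck ltnn.
rewrite -leqNgt => eay _ Hs Hl.
by have := HCb k y s eay (C_ge _ _ _ eay Hs) Hl; rewrite eqxx.
Qed.

Lemma lower_coloring g k a : exists C, (forall u v, C u v < k.+1) /\
  forall j x s, a <= x -> path (color_edge C j) x s ->
    last x s < F (oaddn g k) a ->
    size s < F g x.
Proof.
elim: k a => [|k IH] a.
  exists (fun _ _ => 0); split=> // j x s ax /color_path_ltn /ltn_path_last.
  move=> H /(leq_ltn_trans H) Hs.
  apply: leq_trans (F_mono g ax); apply: leq_ltn_trans Hs.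
  exact: leq_addl.
have [C [C_lt HC]] := blocks IH a.+1 a.
exists C; split=> // j x s ax Hs; rewrite /= F_osucc => Hl.
(* A chain of the new color has at most [a] edges, and a <= x < F_g x. *)
have := HC j x s ax Hs Hl; case: ifP => // _ /leq_trans; apply.
exact: leq_ltn_trans ax (F_gt g x).
Qed.

Lemma ramsey_lower g k a R :
  weak_ramsey (F g) k.+1 a R -> F (oaddn g k) a <= R.
Proof.
move=> HR; rewrite leqNgt; apply/negP => RF.
have [C [C_lt HC]] := lower_coloring g k a.
have [[|x s] [nH Hs Ha wh sz]] := HR C (fun u v _ _ _ => C_lt u v).
  by [].
have [j Hj] := weakly_homogeneous_path Hs wh.
move/allP: Ha => Ha; have /andP[ax _] := Ha x (mem_head _ _).
have /andP[_ lR] := Ha _ (mem_last x s).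
have := HC j x s ax Hj (leq_ltn_trans lR RF).
by rewrite ltnNge -ltnS sz.
Qed.

(** * A fast growing hierarchy with step [h], and the counting of subspaces *)

(** For [h] the identity these are the finite levels F_p. *)
Fixpoint hfast (h : nat -> nat) (p t : nat) : nat :=
  if p is q.+1 then iter (h t).+1 (hfast h q) t else t.+1.

Lemma hfast_ge h p t : t <= hfast h p t.
Proof.
elim: p t => // p IH t; exact: (@iter_inflate _ (h t).+1).
Qed.

Lemma hfast_leS h p t : hfast h p t <= hfast h p.+1 t.
Proof.
by rewrite /= -iterS iterSr; apply: iter_inflate => y; exact: hfast_ge.
Qed.

Lemma hfast_mono h p : {homo h : x y / x <= y} ->
  {homo hfast h p : x y / x <= y}.
Proof.
move=> Hh; elim: p => // p IH x y xy; apply: (@leq_iter _ _ (h x).+1) => //.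
- exact: hfast_ge.
- exact: Hh.
Qed.

Lemma leq_iter_hfast h p m n x y : {homo h : x y / x <= y} ->
  m <= n -> x <= y -> iter m (hfast h p) x <= iter n (hfast h p) y.
Proof.
by move=> Hh mn xy; apply: leq_iter; [exact: hfast_mono|exact: hfast_ge| |].
Qed.

(* Bounds the time reached from time t when n i subspaces of dimension i are
   left; exhausting the low dimensions first is the slowest strategy. *)
Fixpoint Phi (h : nat -> nat) (p : nat) (n : nat -> nat) (t : nat) : nat :=
  iter (n p) (hfast h p) (if p is q.+1 then Phi h q n t else t).

Lemma Phi_ge h p n t : t <= Phi h p n t.
Proof.
elim: p => [|p IH] /=; first exact: iter_inflate.
by apply: leq_trans IH _; apply: iter_inflate => y; exact: (hfast_ge h p.+1).
Qed.

Lemma Phi_mono h p n n' t : {homo h : x y / x <= y} ->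
  (forall i, i <= p -> n i <= n' i) -> Phi h p n t <= Phi h p n' t.
Proof.
move=> Hh; elim: p => [|p IH] Hn.
  exact: (@leq_iter_hfast h 0 _ _ _ _ Hh (Hn 0 _)).
apply: (@leq_iter_hfast h p.+1 _ _ _ _ Hh (Hn _ (leqnn _))).
by apply: IH => i ip; apply: Hn; exact: leqW.
Qed.

Lemma eq_Phi h p n n' t :
  (forall i, i <= p -> n i = n' i) -> Phi h p n t = Phi h p n' t.
Proof.
elim: p => [|p IH] Hn /=; rewrite Hn // IH // => i ip.
exact/Hn/leqW.
Qed.

Lemma Phi_bump h p n k t :
  Phi h p (fun i => n i + (i == p) * k) t =
  iter k (hfast h p) (Phi h p n t).
Proof.
case: p => [|p] /=; rewrite ?eqxx mul1n addnC iterD //.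
rewrite (@eq_Phi h p _ n) // => i ip.
by rewrite ltn_eqF // addn0.
Qed.

Lemma Phi0 h p t : Phi h p (fun=> 0) t = t.
Proof. by elim: p. Qed.

Lemma Phi_time h p n t : {homo h : x y / x <= y} ->
  Phi h p n t.+1 <= hfast h p (Phi h p n t).
Proof.
move=> Hh; elim: p => [|p IH] /=; first by rewrite -iterS iterSr.
rewrite -[X in _ <= X]/(iter (n p.+1).+1 (hfast h p.+1) (Phi h p n t)).
rewrite iterSr; apply: (@leq_iter_hfast h p.+1) => //.
exact: leq_trans IH (hfast_leS _ _ _).
Qed.

(* Spending dimension q before the smaller ones is harmless: by [Phi_time] the
   delay it causes below costs one step of [hfast h q.-1], which is the extra
   iteration in [hfast h q]. *)
Lemma Phi_step h p q (n n' : nat -> nat) t :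
  {homo h : x y / x <= y} -> q <= p ->
  (forall i, n' i + (i == q) <= n i + (i.+1 == q) * h t) ->
  Phi h p n' t.+1 <= Phi h p n t.
Proof.
move=> Hh; elim: p => [|p IH].
  rewrite leqn0 => /eqP -> /(_ 0) /=; rewrite mul0n addn0 addn1 => Hn.
  by rewrite -iterSr; exact: (@leq_iter_hfast h 0).
rewrite leq_eqVlt ltnS => /predU1P[-> Hn|qp Hn]; last first.
  have := Hn p.+1; rewrite !gtn_eqF ?ltnS ?(leqW qp) //.
  rewrite mul0n !addn0 => Hp; apply: (@leq_iter_hfast h p.+1) => //.
  exact: IH.
have := Hn p.+1; rewrite eqxx addn1 gtn_eqF // mul0n addn0 => Hp.
apply: leq_trans (leq_iter_hfast p.+1 Hh Hp (leqnn _)).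
rewrite iterSr; apply: leq_iter_hfast => //.
set u := Phi h p n t.
pose n1 i := n i + (i == p) * h t.
apply: (@leq_trans (Phi h p n1 t.+1)).
  apply: Phi_mono => // i ip; have := Hn i.
  by rewrite ltn_eqF // addn0 eqSS.
rewrite Phi_bump.
(* The new subspaces take [h t] calls and the delay one; as t <= u, these fit into the h u + 1 calls
   made by [hfast h p.+1 u]. *)
apply: (@leq_trans (iter (h t).+1 (hfast h p) u)).
  by rewrite iterSr; apply: leq_iter_hfast => //; exact: Phi_time.
by apply: leq_iter_hfast => //; rewrite ltnS; apply/Hh/Phi_ge.
Qed.

(** * Length of controlled bad sequences *)

(* An item (D, P) is a subspace: D lists its free coordinates, and P the
   indices of the terms it still has to cover. *)
Definition dcount (L : seq (seq nat * seq nat)) (i : nat) : nat :=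
  count (fun it => size it.1 == i) L.

Definition bad_item (ell : nat -> nat -> nat) (f : nat -> nat) (c : nat)
    (it : seq nat * seq nat) : Prop :=
  [/\ size it.1 <= c,
      {in it.1 & it.2, forall j u, ell j u <= f u} &
      {in it.2 &, forall u v, u < v -> has (fun j => ell j v < ell j u) it.1}].

(** A later term of the item lies below term [t] in some free coordinate [j]; one child freezes [j]
    at each value it may take. *)
Definition children (ell : nat -> nat -> nat) (t : nat)
    (it : seq nat * seq nat) : seq (seq nat * seq nat) :=
  [seq (rem j it.1, [seq u <- it.2 | ell j u == s])
     | j <- it.1, s <- iota 0 (ell j t)].

Lemma size_children ell f c t it : bad_item ell f c it -> t \in it.2 ->
  size (children ell t it) <= c * f t.
Proof.
case=> Hc Hf _ Ht; apply: (@leq_trans (size it.1 * f t)); last first.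
  by rewrite leq_mul2r Hc orbT.
have {}Hf : {in it.1, forall j, ell j t <= f t} by move=> j /Hf; apply.
rewrite size_allpairs_dep {Hc}; elim: (it.1) Hf => //= j D IH Hf.
rewrite size_iota mulSn leq_add ?Hf ?mem_head //.
by apply: IH => i Hi; apply: Hf; rewrite inE Hi orbT.
Qed.

(** Terms of a child agree in [j], so the drop between two of them occurs in another free
    coordinate. *)
Lemma children_bad ell f c t it it' : bad_item ell f c it ->
  it' \in children ell t it ->
  bad_item ell f c it' /\ (size it'.1).+1 = size it.1.
Proof.
case=> Hc Hf Hb /allpairsPdep [j [s [jD _ ->]]] /=; split; last first.
  by rewrite size_rem // prednK //; case: (it.1) jD.
split=> /=.
- by apply: leq_trans Hc; rewrite size_rem // leq_pred.
- move=> i u /mem_rem Hi; rewrite mem_filter => /andP[_]; exact: Hf.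
- move=> u v; rewrite !mem_filter => /andP[/eqP us Hu] /andP[/eqP vs Hv] uv.
  have /hasP[i Hi Hlt] := Hb u v Hu Hv uv.
  apply/hasP; exists i => //; move: Hi; rewrite (perm_mem (perm_to_rem jD)).
  rewrite inE => /predU1P[ij|//].
  by move: Hlt; rewrite ij us vs ltnn.
Qed.

(** Induction on [N - t]: an item covering [t] is replaced by its children, which cover its later
    terms, and [Phi_step] accounts for the exchange. *)
Lemma bad_length ell f c N L t : {homo f : x y / x <= y} ->
  (forall it, it \in L -> bad_item ell f c it) ->
  (forall u, t <= u < N -> exists2 it, it \in L & u \in it.2) ->
  N <= Phi (fun x => c * f x) c (dcount L) t.
Proof.
move=> Hf; have Hh : {homo (fun x => c * f x) : x y / x <= y}.
  by move=> x y xy; rewrite leq_mul2l Hf ?orbT.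
move: {2}(N - t) (leqnn (N - t)) => k; elim: k L t => [|k IH] L t Hk Hbad Hcov.
  apply: leq_trans (Phi_ge _ _ _ _).
  by rewrite -subn_eq0 -leqn0.
have [Nt|tN] := leqP N t; first exact: leq_trans Nt (Phi_ge _ _ _ _).
have [it itL tit] := Hcov t (introT andP (conj (leqnn t) tN)).
have itbad := Hbad _ itL.
pose L' := rem it L ++ children ell t it.
apply: (@leq_trans (Phi (fun x => c * f x) c (dcount L') t.+1)).
  apply: IH => [|it'|u /andP[tu uN]].
  - by rewrite subnS -subn1 leq_subLR add1n.
  - by rewrite mem_cat => /orP[/mem_rem /Hbad //|/(children_bad itbad) []].
  - have [it1 it1L uit1] := Hcov u (introT andP (conj (ltnW tu) uN)).
    move: it1L; rewrite (perm_mem (perm_to_rem itL)) inE.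
    case/predU1P=> [E|it1L]; last by exists it1 => //; rewrite mem_cat it1L.
    subst it1; case: itbad => _ _ /(_ t u tit uit1 tu) /hasP[j jD jlt].
    exists (rem j it.1, [seq v <- it.2 | ell j v == ell j u]) => /=.
      rewrite mem_cat orbC; apply/orP; left; apply/allpairsPdep.
      by exists j, (ell j u); rewrite mem_iota.
    by rewrite mem_filter eqxx.
apply: (@Phi_step _ _ (size it.1)) => //; first by case: itbad.
move=> i; rewrite /dcount (permP (perm_to_rem itL)) /= count_cat.
rewrite (eq_sym (size _)).
rewrite addnC -!addnA leq_add2l leq_add2l.
case: (eqVneq i.+1 (size it.1)) => [_|ne].
  rewrite mul1n; apply: leq_trans (size_children itbad tit).
  exact: count_size.
rewrite mul0n leqNgt -has_count.
apply/hasPn => it' /(children_bad itbad)[_ E].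
by rewrite -eqSS E eq_sym.
Qed.

(** * Chain-length labels and the Ramsey property *)

(* Number of edges of a longest chain of color j from n within [n, R], provided
   the fuel k is at least R - n. *)
Fixpoint ell (C : nat -> nat -> nat) (R k j n : nat) : nat :=
  if k is k'.+1 then
    \max_(n.+1 <= m < R.+1 | C n m == j) (ell C R k' j m).+1
  else 0.

Lemma ell_leS C R k j n : ell C R k j n <= ell C R k.+1 j n.
Proof.
elim: k n => // k IH n; rewrite [ell _ _ k.+1 _ _]/= [ell _ _ k.+2 _ _]/=.
apply/bigmax_leqP_seq => m mr Cm.
by apply: leq_trans (leq_bigmax_seq m mr Cm); rewrite ltnS.
Qed.

Lemma ell_mono C R k k' j n : k <= k' -> ell C R k j n <= ell C R k' j n.
Proof.
move/subnKC <-; elim: (k' - k) => [|d IH]; first by rewrite addn0.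
by rewrite addnS; exact: leq_trans IH (ell_leS _ _ _ _ _).
Qed.

(** The edge from n to m prolongs every chain from m; the fuel suffices because R - m + 1 <= R -
    n. *)
Lemma ell_lt C R j n m : n < m <= R -> C n m = j ->
  ell C R (R - m) j m < ell C R (R - n) j n.
Proof.
move=> /andP[nm mR] Cj; have nR := leq_trans nm mR.
apply: (@leq_trans (ell C R (R - m).+1 j n)); last first.
  by apply: ell_mono; rewrite -(subnSK nR) ltnS leq_sub2l.
apply: (@leq_bigmax_seq _ _ _ (fun l => (ell C R (R - m) j l).+1)).
  by rewrite mem_index_iota nm ltnS.
exact/eqP.
Qed.

Lemma ell_chain C R k j n : n <= R ->
  exists s, [/\ path (color_edge C j) n s, all (leq^~ R) s &
    size s = ell C R k j n].
Proof.
elim: k n => [|k IH] n nR; first by exists [::].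
rewrite /= big_seq_cond.
apply: (big_ind (fun l => exists s,
  [/\ path (color_edge C j) n s, all (leq^~ R) s & size s = l])).
- by exists [::].
- by move=> x y Hx Hy; rewrite /maxn; case: ifP.
- move=> m; rewrite mem_index_iota ltnS => /andP[/andP[nm mR] Cj].
  have [s [Hs Ha <-]] := IH m mR.
  by exists (m :: s); rewrite /= {1}/color_edge nm Cj Hs mR Ha.
Qed.

Lemma weak_ramsey_hfast f c a : {homo f : x y / x <= y} ->
  weak_ramsey f c a (hfast (fun x => c * f x) c a).
Proof.
move=> Hf C HC; set R := hfast _ _ _.
pose l j n := ell C R (R - n) j n.
(* Either some label reaches [f n], and its chain has more than [f n] elements, or all labels stay
   below [f]. *)
case: (boolP (has (fun j => has (fun n => f n <= l j n) (iota a (R.+1 - a)))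
                  (iota 0 c))) => [/hasP[j _ /hasP[n nR fn]]|/hasPn no].
  move: nR; rewrite mem_iota => /andP[an nR].
  have {}nR : n <= R.
    by move: nR; rewrite subnKC // leqW // hfast_ge.
  have [s [Hs Ha Hl]] := ell_chain C (R - n) j nR.
  exists (n :: s); split=> //; last by rewrite /= ltnS Hl.
  - exact: color_path_ltn Hs.
  - rewrite /= an nR; apply/allP => m Hm; rewrite (allP Ha) // andbT.
    have := order_path_min ltn_trans (color_path_ltn Hs).
    by move/allP/(_ m Hm)/ltnW; apply: leq_trans.
  - exact: path_weakly_homogeneous Hs.
exfalso.
(* The full space of dimension [c] covers all of [a, R]; from u to v the coordinate [C u v]
   drops. *)
have: R.+1 <= Phi (fun x => c * f x) c
    (dcount [:: (iota 0 c, iota a (R.+1 - a))]) a.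
  apply: (@bad_length l) => // [it|u /andP[au uR]]; last first.
    exists (iota 0 c, iota a (R.+1 - a)); rewrite ?mem_head //.
    by rewrite mem_iota au subnKC // (leq_trans au) // ltnW.
  rewrite inE => /eqP ->; split=> /=.
  - by rewrite size_iota.
  - by move=> j u /no/hasPn + Hu => /(_ u Hu); rewrite -ltnNge => /ltnW.
  - move=> u v; rewrite !mem_iota subnKC ?ltnS; last first.
      by rewrite leqW // hfast_ge.
    move=> /andP[au uR] /andP[av vR] uv; apply/hasP; exists (C u v).
      by rewrite mem_iota /= HC.
    by apply: ell_lt; rewrite ?uv.
(* A single subspace of dimension [c] costs one call of [hfast] at level [c], which is [R] itself: R
   + 1 <= R is absurd. *)
rewrite (@eq_Phi _ _ _ (fun i => 0 + (i == c) * 1)) => [|i _].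
  by rewrite Phi_bump Phi0 ltnn.
by rewrite /dcount /= size_iota muln1 addn0 eq_sym.
Qed.

(** * Existence of the Ramsey number and majorization of its bound *)

Lemma exists_minn (P : nat -> Prop) n :
  P n -> exists2 m, P m & forall k, P k -> m <= k.
Proof.
elim/ltn_ind: n => n IH Pn.
case: (classic (exists2 k, k < n & P k)) => [[k kn /(IH k kn) //]|no].
exists n => // k Pk; rewrite leqNgt; apply/negP => kn.
by apply: no; exists k.
Qed.

Lemma ramsey_number_exists f c a : {homo f : x y / x <= y} ->
  exists2 R, is_ramsey_number f c a R & R <= hfast (fun x => c * f x) c a.
Proof.
move=> Hf; have HG := @weak_ramsey_hfast f c a Hf.
have [R HR Rmin] := exists_minn HG.
by exists R; [split|exact: Rmin].
Qed.

(** Level 1 is x + 1 + h x, still below an iterate of [F g]; only the later levels raise the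
    ordinal, whence the index g + c - 1 for [c] colors. *)
Lemma hfast_majorized g h m p : g <> Zero ->
  (forall x, h x <= iter m (F g) x) ->
  exists n, forall x, hfast h p.+1 x <= iter n (F (oaddn g p)) x.
Proof.
move=> gn0 Hh; elim: p => [|p [n Hn]].
  exists (maxn 1 m).+1 => x.
  have -> : hfast h 1 x = x.+1 + h x.
    have E k y : iter k (hfast h 0) y = y + k.
      by elim: k => [|k IH]; rewrite ?addn0 //= IH addnS.
    by rewrite [LHS](E (h x).+1) addnS addSn.
  exact: (@iterF_add g 1 m _ _ _ gn0 (F_gt g x) (Hh x)).
have iterG k x : iter k (hfast h p.+1) x <= iter (k * n) (F (oaddn g p)) x.
  elim: k => // k IH; rewrite mulSn iterD; apply: leq_trans (Hn _) _.
  exact: leq_iterF.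
(* [F_{d+1} y] absorbs any number at most [y] of iterations of [F_d]
   started below [y]. *)
pose y x := n * (h x).+1 + x.
have Hy x : hfast h p.+2 x <= F (oaddn g p.+1) (y x).
  apply: leq_trans (iterG (h x).+1 x) _; rewrite /= F_osucc.
  apply: leq_iterF; last exact: leq_addl.
  by rewrite mulnC leqW // leq_addr.
have [k Hk] : exists k, forall x, y x <= iter k (F g) x.
  (* Bounding h x + 1 takes max(m, 1) + 1 iterations, the factor [n] takes [n] more, and the summand
     [x] one more. *)
  exists (maxn (n + (maxn m 1).+1) 0).+1 => x; apply: iterF_add => //.
  rewrite iterD; apply: leq_trans (iterF_mul n _ gn0).
  rewrite leq_mul2l -addn1; apply/orP; right.
  apply: iterF_add => //; exact: iterF_const.
exists k.+1 => x; apply: leq_trans (Hy x) _; apply: F_mono.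
exact: leq_trans (Hk x) (leq_iterF_oaddn _ _ _ _).
Qed.

Theorem corollary11 :
  (forall (g : ord) (f : nat -> nat),
      nf g -> ole oone g ->
      fclass1 g f ->
      (forall x y : nat, x <= y -> f x <= f y) ->
      (forall x : nat, maxn 1 x <= f x) ->
      forall c : nat, 1 <= c ->
      exists M : nat -> nat,
        fclass1 (oaddn g (c - 1)) M /\
        forall a : nat, exists R : nat,
          is_ramsey_number f c a R /\ R <= M a) /\
  (forall (g : ord) (c : nat),
      nf g -> 1 <= c ->
      forall a : nat, exists R : nat,
        is_ramsey_number (F g) c a R /\ F (oaddn g (c - 1)) a <= R).
Proof.
split=> [g f _ g1 fg Hf _ [//|p] _|g [//|p] _ _ a]; rewrite subn1 /=.
- have gn0 : g <> Zero by move=> E; rewrite E in g1.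
  have [m Hm] := fclass1_majorized gn0 fg.
  have Hh x : p.+1 * f x <= iter (p.+1 + m) (F g) x.
    rewrite iterD; apply: leq_trans (iterF_mul p.+1 _ gn0).
    by rewrite leq_mul2l Hm orbT.
  have [n Hn] := hfast_majorized p gn0 Hh.
  exists (iter n (F (oaddn g p))); split; first exact: fclass1_iterF.
  move=> a; have [R HR RG] := @ramsey_number_exists f p.+1 a Hf.
  by exists R; split=> //; exact: leq_trans RG (Hn a).
- have [R HR _] := @ramsey_number_exists (F g) p.+1 a (@F_mono g).
  by exists R; split=> //; case: HR => /ramsey_lower.
Qed.
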